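(* Let $\varepsilon \geq 0$ be real, and suppose that there exist a constant $c(\varepsilon)$ and an integer $N(\varepsilon) \geq 20$ such that, for all integers $n > N(\varepsilon)$, \[ \left|\frac{1}{p_n} - \frac{1}{p_{n+1}}\right| \leq c(\varepsilon) \left|\frac{1}{n} - \frac{1}{n+1}\right|^{1-\varepsilon}. \] Then, for all sufficiently large $n$, we have \[ p_{n+1} - p_n \leq 2c(\varepsilon)\, (n^\varepsilon \log n)^2. \]
   Context: $p_n$ denotes the $n$th prime number, indexed by positive integers $n \geq 1$ in increasing order ($p_1 = 2$, $p_2 = 3$, ...). $\log$ is the natural logarithm. The constant $c(\varepsilon)$ in the conclusion is the same as the one in the hypothesis. *)

(* Defs.v *)
From mathcomp Require Import all_boot all_order all_algebra.
From mathcomp Require Import all_classical all_reals all_analysis.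

Set Implicit Arguments.
Unset Strict Implicit.
Unset Printing Implicit Defensive.

Lemma exists_prime_gt (m : nat) : exists p, (m < p) && prime p.
Proof. by have [p mp pp] := prime_above m; exists p; rewrite mp. Qed.

Definition next_prime (m : nat) : nat := ex_minn (exists_prime_gt m).

(* Indexed from 1: nth_prime 1 = 2.  The value nth_prime 0 = 0 is only a
   starting point for the recursion, not a prime. *)
Fixpoint nth_prime (n : nat) : nat :=
  if n is n'.+1 then next_prime (nth_prime n') else 0.

Lemma next_primeP (m : nat) :
  [/\ prime (next_prime m), m < next_prime m &
      forall q, prime q -> m < q -> next_prime m <= q].
Proof.
rewrite /next_prime; case: ex_minnP => p /andP[mp pp] minp; split=> // q qq mq.
by apply: minp; rewrite mq.
Qed.

Lemma nth_prime1 : nth_prime 1 = 2.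
Proof.
have [pp _ minp] := next_primeP 0.
by apply/eqP; rewrite eqn_leq prime_gt1 // minp.
Qed.

Lemma prime_nth_prime (n : nat) : 0 < n -> prime (nth_prime n).
Proof. by case: n => // n _; have [] := next_primeP (nth_prime n). Qed.

Lemma nth_prime_ltS (n : nat) : nth_prime n < nth_prime n.+1.
Proof. by have [] := next_primeP (nth_prime n). Qed.

Lemma nth_prime_surj (q : nat) :
  prime q -> exists2 n, 0 < n & nth_prime n = q.
Proof.
move=> qq.
have le_nth n : n <= nth_prime n.
  by elim: n => // n IHn; apply: leq_ltn_trans IHn (nth_prime_ltS n).
have exn : exists n, q <= nth_prime n by exists q.
case: (ex_minnP exn) => -[|n] qn minn.
  by move: qn; rewrite leqNgt prime_gt0.
exists n.+1 => //; apply/eqP; rewrite eqn_leq qn andbT.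
have [_ _ minq] := next_primeP (nth_prime n).
apply: minq => //; rewrite ltnNge; apply/negP => /minn.
by rewrite ltnn.
Qed.

(* Main.v *)
(** Since 1/p - 1/q = (q - p)/(p q) and 1/n - 1/(n+1) = 1/(n (n+1)), the
    hypothesis reads
      p_{n+1} - p_n <= c p_n p_{n+1} (n (n+1))^eps / (n (n+1)),
    so any bound p_{n+1} <= a n log n with a^2 < 2 suffices.  The central
    binomial coefficient only gives a = 1/log 2 > sqrt 2; instead one uses
    Chebyshev's method with the integer ratio
      (6m)! m! / ((3m)! (2m)!^2),
    which is at least 81^m / 3, while its p-part is at most 6m for every prime
    p <= 6m and 1 for the others.  If p_{k+1} > 6m there are at most k such
    primes, so 81^m <= 3 (6m)^k; choosing 6m close to (7/5) k log k
    contradicts this because (7/5) (log 81)/6 > 1, and (7/5)^2 < 2. *)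

Require Import Defs.
From mathcomp Require Import all_boot all_order all_algebra.
From mathcomp Require Import all_classical all_reals all_analysis.
From mathcomp Require Import zify ring lra.
Import Order.TTheory GRing.Theory Num.Theory.
Import numFieldNormedType.Exports.
Local Open Scope classical_set_scope.

(** * Prime factorisation of the ratio (6m)! m! / ((3m)! (2m)!^2) *)

Lemma logn_fact_wide (p n N : nat) : prime p -> n <= N ->
  logn p n`! = \sum_(1 <= k < N.+1) n %/ p ^ k.
Proof.
move=> pp nN; rewrite logn_fact // [RHS](big_cat_nat (n:=n.+1)) //=.
rewrite [X in _ = _ + X]big_nat_cond [X in _ = _ + X]big1 ?addn0 // => k.
rewrite andbT => /andP[nk _]; rewrite divn_small //.
by apply: (leq_trans nk); rewrite ltnW // ltn_expl // prime_gt1.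
Qed.

(** With m = a q + r, the multiples of a cancel because 6 + 1 = 3 + 2 * 2. What remains is a check
    over the six possible values of 6r / q, each of which forces lower bounds on 3r / q and 2r /
    q. *)
Lemma divn_chebyshev (m q : nat) : 0 < q ->
  6 * m %/ q + m %/ q <= 3 * m %/ q + 2 * (2 * m %/ q) + (q <= 6 * m).
Proof.
move=> q0; have [qm|mq] := leqP q (6 * m); last first.
  by rewrite !divn_small //; lia.
set a := m %/ q; set r := m %% q.
have mE : m = a * q + r by exact: divn_eq.
have rq : r < q by rewrite ltn_mod.
have E j : j * m %/ q = j * a + j * r %/ q.
  by rewrite mE mulnDr mulnA divnMDl.
rewrite !E; set b := 6 * r %/ q.
have bl : b * q <= 6 * r by exact: leq_divM.
have bu : b < 6 by rewrite ltn_divLR //; lia.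
have D j i : i * q <= j * r -> i <= j * r %/ q by rewrite leq_divRL.
move: (D 3 1) (D 3 2) (D 2 1) => D1 D2 D3.
move: D1 D2 D3.
move: (3 * r %/ q) (2 * r %/ q) => d3 d2 D1 D2 D3.
move: bu bl; clearbody b a r; clear E D mE qm.
by case: b => [|[|[|[|[|[|//]]]]]] _ bl; lia.
Qed.

Lemma sum_expn_leq (p N : nat) : 1 < p -> 0 < N ->
  \sum_(1 <= k < N.+1) (p ^ k <= N) <= trunc_log p N.
Proof.
move=> p1 N0; set t := trunc_log p N.
have tN : t.+1 <= N.+1.
  by rewrite ltnS; apply/ltnW/(leq_trans (ltn_expl t p1))/trunc_logP.
rewrite (big_cat_nat (n:=t.+1)) //= [X in _ + X]big_nat_cond.
rewrite [X in _ + X]big1 ?addn0.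
  have tE : \sum_(1 <= k < t.+1) 1 = t.
    by rewrite sum_nat_const_nat muln1 subn1.
  by apply: (leq_trans _ (eq_leq tE)); apply: leq_sum => k _; exact: leq_b1.
move=> k /andP[/andP[tk _] _]; apply/eqP; rewrite eqb0 -ltnNge.
by apply: (leq_trans (trunc_log_ltn N p1)); rewrite leq_exp2l.
Qed.

Lemma logn_fact_ratio (p m : nat) : prime p -> 0 < m ->
  logn p ((6 * m)`! * m`!) <=
  logn p ((3 * m)`! * (2 * m)`! ^ 2) + trunc_log p (6 * m).
Proof.
move=> pp m0; rewrite !lognM ?muln_gt0 ?fact_gt0 //.
(* A single summation range for all the factorials lets Legendre's formula be compared term by
   term. *)
rewrite !(@logn_fact_wide p _ (6 * m)) //; try lia.
apply: (@leq_trans (\sum_(1 <= k < (6 * m).+1)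
   (3 * m %/ p ^ k + (2 * m %/ p ^ k + 2 * m %/ p ^ k)
    + (p ^ k <= 6 * m)))).
  rewrite -big_split /=; apply: leq_sum => k _; rewrite addnn -mul2n.
  by apply: divn_chebyshev; rewrite expn_gt0 prime_gt0.
rewrite !big_split /= leq_add2l sum_expn_leq ?prime_gt1 //.
lia.
Qed.

Lemma leq_nth_prime (i j : nat) : i <= j -> nth_prime i <= nth_prime j.
Proof.
apply: (@homo_leq nat nth_prime leq) => // [a b c|k]; first exact: leq_trans.
exact/ltnW/nth_prime_ltS.
Qed.

Lemma fact_ratio_le_expn (k m : nat) : 6 * m < nth_prime k.+1 -> 0 < m ->
  (6 * m)`! * m`! <= (3 * m)`! * (2 * m)`! ^ 2 * (6 * m) ^ k.
Proof.
move=> mk m0.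
(* [L] is the lcm of 1, ..., 6m: every prime up to 6m is among the first k, and a larger one gets
   exponent 0. The numerator divides the denominator times [L], and each of the k factors of [L] is
   at most 6m. *)
set L := \prod_(1 <= i < k.+1) nth_prime i ^ trunc_log (nth_prime i) (6 * m).
have Lle : L <= (6 * m) ^ k.
  have -> : (6 * m) ^ k = \prod_(1 <= i < k.+1) (6 * m).
    by rewrite prod_nat_const_nat subn1.
  rewrite /L !big_nat; apply: leq_prod => i /andP[i0 _].
  by apply: trunc_logP; [rewrite prime_gt1 ?prime_nth_prime | lia].
have L0 : 0 < L.
  rewrite /L big_nat_cond prodn_cond_gt0 // => i /andP[/andP[i0 _] _].
  by rewrite expn_gt0 prime_gt0 ?prime_nth_prime.
apply: leq_trans (_ : _ <= (3 * m)`! * (2 * m)`! ^ 2 * L) _; last first.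
  by rewrite leq_mul2l Lle orbT.
apply: dvdn_leq; first by rewrite !muln_gt0 L0 !fact_gt0.
have M0 : 0 < (6 * m)`! * m`! by rewrite muln_gt0 !fact_gt0.
apply/dvdn_partP => // p.
rewrite mem_primes => /and3P[pp _ pM].
have p6m : p <= 6 * m.
  have F j : p %| j`! -> p <= j.
    elim: j => [|j IH].
      by rewrite fact0 dvdn1 => /eqP pE; move: pp; rewrite pE.
    by rewrite factS Euclid_dvdM // => /orP[/dvdn_leq->//|/IH /leqW].
  by move: pM; rewrite Euclid_dvdM // => /orP[/F//|/F]; lia.
rewrite p_part pfactor_dvdn // ?muln_gt0 ?L0 ?fact_gt0 //.
apply: (leq_trans (logn_fact_ratio _ _ pp m0)).
rewrite [leqRHS]lognM // ?muln_gt0 ?fact_gt0 // leq_add2l.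
rewrite -pfactor_dvdn //.
have [i i0 ip] := nth_prime_surj pp.
have ik : i < k.+1.
  rewrite ltnNge; apply/negP => /leq_nth_prime; rewrite ip => kp.
  by have := leq_trans (leq_trans mk kp) p6m; rewrite ltnn.
rewrite /L (bigD1_seq i) /= ?mem_index_iota ?i0 ?iota_uniq //.
by rewrite ip dvdn_mulr.
Qed.

(** * Growth of the ratio *)

Lemma fact_ratioS (m : nat) :
  (6 * m.+1)`! * m.+1`! * ((2 * m).+1 * m.+1) * ((3 * m)`! * (2 * m)`! ^ 2) =
  6 * (6 * m).+1 * (6 * m + 5) *
  ((6 * m)`! * m`! * ((3 * m.+1)`! * (2 * m.+1)`! ^ 2)).
Proof.
have -> : 6 * m.+1 = (6 * m).+4.+2 by lia.
have -> : 3 * m.+1 = (3 * m).+3 by lia.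
have -> : 2 * m.+1 = (2 * m).+2 by lia.
rewrite !factS.
set A := (6 * m)`!; set B := m`!; set C := (3 * m)`!; set D := (2 * m)`!.
move: A B C D => A B C D; lia.
Qed.

(** The quotient of consecutive ratios, 6(6j+1)(6j+5) / ((2j+1)(j+1)), tends to 108 and is at least
    81 from j = 2 on. The factor 3 absorbs the start, where the ratios are 1, 30 and 2310. *)
Lemma fact_ratio_ge (m : nat) :
  81 ^ m * ((3 * m)`! * (2 * m)`! ^ 2) <= 3 * ((6 * m)`! * m`!).
Proof.
pose M m := (6 * m)`! * m`!; pose D m := (3 * m)`! * (2 * m)`! ^ 2.
have D0 j : 0 < D j by rewrite !muln_gt0 !fact_gt0.
have S j : M j.+1 * ((2 * j).+1 * j.+1) * D j =
   6 * (6 * j).+1 * (6 * j + 5) * (M j * D j.+1) := fact_ratioS j.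
have M00 : M 0 = 1 by [].
have D00 : D 0 = 1 by [].
rewrite -/(M m) -/(D m); clearbody M D.
have M1 : M 1 = 30 * D 1 by have := S 0; rewrite M00 D00; lia.
have M2 : M 2 = 2310 * D 2 by have := S 1; have := D0 1; rewrite M1; nia.
elim: m => [|[|[|m]] IH]; first by rewrite M00 D00.
- by rewrite M1; lia.
- by rewrite M2; have := D0 2; lia.
set j := m.+2 in IH *.
have P0 : 0 < (2 * j).+1 * j.+1 * D j by rewrite !muln_gt0 D0.
rewrite -(leq_pmul2r P0) -[leqRHS]mulnA [M _ * _]mulnA S expnS.
have growth : 81 * ((2 * j).+1 * j.+1) <= 6 * (6 * j).+1 * (6 * j + 5) by nia.
have := leq_mul (leq_mul growth IH) (leqnn (D j.+1)).
by congr (_ <= _); ring.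
Qed.

Lemma nth_prime_le_of_expn (k m : nat) :
  0 < m -> 3 * (6 * m) ^ k < 81 ^ m -> nth_prime k.+1 <= 6 * m.
Proof.
move=> m0; apply: contraTT; rewrite -ltnNge -leqNgt => mk.
have D0 : 0 < (3 * m)`! * (2 * m)`! ^ 2 by rewrite !muln_gt0 !fact_gt0.
rewrite -(leq_pmul2r D0); apply: (leq_trans (fact_ratio_ge m)).
by rewrite -mulnA leq_mul2l /= [leqRHS]mulnC fact_ratio_le_expn.
Qed.

(** * Logarithmic estimates and the bound on p_{n+1} *)

Local Open Scope ring_scope.

(** The choice of m requires (7/30) 4 ln 3 > 1, that is ln 3 > 15/14; the value 27/25 yields 1.008.
    It comes from exp(-t) >= 1 - t at t = 3/100, since 0.97^36 >= 1/3. *)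
Lemma ln3_ge (R : realType) : 27 / 25 <= ln 3 :> R.
Proof.
rewrite -[leLHS]expRK ler_ln ?posrE ?expR_gt0 //.
rewrite -[leLHS]invrK -expRN invf_ple ?posrE ?expR_gt0 //.
have -> : - (27 / 25) = 36%:R * (- (3 / 100)) :> R by lra.
rewrite expRM_natl.
have h : 97 / 100 <= expR (- (3 / 100)) :> R.
  by apply: le_trans (expR_ge1Dx _); lra.
apply: le_trans (lerXn2r 36 _ _ h); rewrite ?nnegrE ?expR_ge0 //; lra.
Qed.

(** A weakened tangent line at a; a large a makes the log log n term a small multiple of log n. *)
Lemma ln_le_linear (R : realType) (a x : R) : 0 < a -> 0 < x ->
  ln x <= x / a + ln a.
Proof.
move=> a0 x0; have xa0 : 0 < x / a by rewrite divr_gt0.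
rewrite -{1}(divfK (lt0r_neq0 a0) x) lnM ?posrE // lerD2r.
have := @le_ln1Dx R (x / a - 1); rewrite [1 + _]addrC subrK => h.
by apply: le_trans (h _) _; lra.
Qed.

Lemma near_ln_ge (R : realType) (K : R) : \forall n \near \oo, K <= ln (n%:R : R).
Proof.
exists (Num.trunc (expR K)).+1 => // n /= Kn.
have Kn' : expR K <= n%:R.
  by apply/ltW/(lt_le_trans (truncnS_gt _)); rewrite ler_nat.
rewrite -[leLHS]expRK ler_ln ?posrE ?expR_gt0 //.
exact: lt_le_trans (expR_gt0 _) Kn'.
Qed.

Lemma near_nth_primeS_le (R : realType) : \forall n \near \oo,
  (nth_prime n.+1)%:R <= 7 / 5 * (n%:R * ln n%:R) :> R.
Proof.
set B : R := ln 1000.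
have B0 : 0 <= B by apply: ln_ge0; lra.
near=> n.
have n1 : 1 <= n%:R :> R by rewrite ler1n; near: n; exact: nbhs_infty_gt.
(* With L = ln n, the final comparison has 1.0014 n L on the left and 1.008 n L on the right. The
   gap exceeds n L / 200, which covers n B and the constants: ln 3 <= 2, and 4.32 lost by truncating
   m. *)
have LK : 200 * (7 + B) <= ln n%:R by near: n; exact: near_ln_ge.
set L : R := ln n%:R in LK *.
have nL : n%:R * (200 * (7 + B)) <= n%:R * L by rewrite ler_wpM2l //; lra.
have nB : B <= n%:R * B by rewrite ler_peMl.
set m := Num.trunc (7 / 30 * (n%:R * L)).
have /andP[ml mu] : m%:R <= 7 / 30 * (n%:R * L) < m.+1%:R.
  by apply: truncn_itv; lra.
have m0 : (0 < m)%N by rewrite truncn_gt0; lra.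
have m1 : 1 <= m%:R :> R by rewrite ler1n.
suff pm : (nth_prime n.+1 <= 6 * m)%N.
  apply: (@le_trans _ _ (6 * m)%:R); first by rewrite ler_nat.
  by rewrite natrM; lra.
apply: nth_prime_le_of_expn => //.
rewrite -(ltr_nat R) natrM !natrX natrM.
have T1 := ln3_ge R.
have T2 : ln 3 <= 2 :> R.
  by have := @le_ln1Dx R 2; rewrite (_ : 1 + 2 = 3); [apply; lra | lra].
rewrite -ltr_ln ?posrE ?mulr_gt0 ?exprn_gt0 ?mulr_gt0 //; try lra.
rewrite lnM ?posrE ?exprn_gt0 ?mulr_gt0 //; try lra.
rewrite !lnXn ?mulr_gt0 //; try lra.
have -> : ln 81 = 4 * ln 3 :> R.
  by rewrite (_ : 81 = 3 ^+ 4 :> R) ?lnXn ?mulr_natl //; lra.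
rewrite -(mulr_natl (ln (6 * m%:R)) n) -(mulr_natl (4 * ln 3) m).
have l6 : ln (6 * m%:R) <= L + (7 / 5 * L / 1000 + B).
  apply: (@le_trans _ _ (ln (n%:R * (7 / 5 * L)))).
    by rewrite ler_ln ?posrE ?mulr_gt0 //; lra.
  rewrite lnM ?posrE ?lerD2l //; try lra.
  by apply: ln_le_linear; lra.
have l6n : n%:R * ln (6 * m%:R) <= n%:R * (L + (7 / 5 * L / 1000 + B)).
  by rewrite ler_wpM2l //; lra.
have mT : m%:R * (4 * (27 / 25)) <= m%:R * (4 * ln 3) :> R.
  by rewrite ler_wpM2l //; lra.
apply: lt_le_trans mT; move: mu l6n; rewrite -natr1 => mu l6n.
lra.
Unshelve. all: by end_near. Qed.

(** The logarithm of (1 + 1/n)^eps is at most eps / n, hence at most ln a once n >= eps / ln a. *)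
Lemma near_powR_succ_le (R : realType) (eps a : R) : 0 <= eps -> 1 < a ->
  \forall n \near \oo, n.+1%:R `^ eps <= a * n%:R `^ eps.
Proof.
move=> eps0 a1.
have la : 0 < ln a by apply: ln_gt0.
near=> n.
have n0 : 0 < n%:R :> R by rewrite ltr0n; near: n; exact: nbhs_infty_gt.
have nE : eps / ln a <= n%:R by near: n; exact: nbhs_infty_ger.
have -> : n.+1%:R = n%:R * (1 + n%:R^-1) :> R.
  by rewrite -natr1; field; rewrite lt0r_neq0.
have v0 : 0 < n%:R^-1 :> R by rewrite invr_gt0.
have w0 : 0 < 1 + n%:R^-1 :> R by lra.
rewrite powRM ?(ltW n0) ?(ltW w0) // [leRHS]mulrC.
rewrite ler_wpM2l ?powR_ge0 // -ler_ln ?posrE ?powR_gt0 //; try lra.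
rewrite ln_powR.
apply: (@le_trans _ _ (eps * n%:R^-1)).
  by rewrite ler_wpM2l // le_ln1Dx //; lra.
by rewrite ler_pdivrMr // mulrC -ler_pdivrMr.
Unshelve. all: by end_near. Qed.

(** * From the bound on primes to the bound on gaps *)

Theorem theorem1p3 (R : realType) (eps c : R) (N : nat)
    (heps : 0 <= eps) (hN : (20 <= N)%N)
    (hc : forall n : nat, (N < n)%N ->
      `| (nth_prime n)%:R^-1 - (nth_prime n.+1)%:R^-1 |
        <= c * `| n%:R^-1 - n.+1%:R^-1 | `^ (1 - eps)) :
  \forall n \near \oo,
    (nth_prime n.+1)%:R - (nth_prime n)%:R
      <= 2 * c * (n%:R `^ eps * ln n%:R) ^+ 2.
Proof.
(* 50/49 = 2 / (7/5)^2 is exactly the room left for replacing (n+1)^eps by n^eps. *)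
have a1 : 1 < 50 / 49 :> R by lra.
near=> n.
have nN : (N < n)%N by near: n; exact: nbhs_infty_gt.
have n0 : 0 < n%:R :> R by rewrite ltr0n; near: n; exact: nbhs_infty_gt.
have L0 : 1 <= ln n%:R :> R by near: n; exact: near_ln_ge.
have := hc n nN.
have qle : (nth_prime n.+1)%:R <= 7 / 5 * (n%:R * ln n%:R) :> R.
  by near: n; exact: near_nth_primeS_le.
have eS : n.+1%:R `^ eps <= 50 / 49 * n%:R `^ eps :> R.
  by near: n; exact: near_powR_succ_le.
have n1 : 0 < n.+1%:R :> R by rewrite ltr0n.
have nn1 : n%:R <= n.+1%:R :> R by rewrite ler_nat.
have pq : (nth_prime n)%:R < (nth_prime n.+1)%:R :> R.
  by rewrite ltr_nat nth_prime_ltS.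
have p0 : 0 < (nth_prime n)%:R :> R.
  by rewrite ltr0n prime_gt0 ?prime_nth_prime //; exact: leq_ltn_trans nN.
set p : R := (nth_prime n)%:R in pq p0 *.
set q : R := (nth_prime n.+1)%:R in qle pq *.
set x : R := n%:R in n0 nn1 L0 qle eS *.
have yE : x^-1 - n.+1%:R^-1 = (x * n.+1%:R)^-1.
  by rewrite -natr1; field; rewrite natr1 !lt0r_neq0.
set y : R := n.+1%:R in n1 nn1 eS yE *.
have q0 : 0 < q by exact: lt_trans pq.
have pqE : p^-1 - q^-1 = (q - p) / (p * q) by field; rewrite !lt0r_neq0.
have xy0 : 0 < x * y by rewrite mulr_gt0.
have pq0 : 0 < p * q by rewrite mulr_gt0.
rewrite yE pqE (gtr0_norm (divr_gt0 _ pq0)) ?subr_gt0 //.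
rewrite gtr0_norm ?invr_gt0 // ler_pdivrMr // => hq.
have E : (x * y)^-1 `^ (1 - eps) = (x `^ eps * y `^ eps) / (x * y).
  rewrite -(powR_inv1 (ltW xy0)) -powRrM.
  have -> : -1 * (1 - eps) = eps + -1 by ring.
  by rewrite powRD ?lt0r_neq0 ?implybT // powRM ?ltW.
(* The sign of c is forced by the positive gap q - p; it allows c to be cancelled. *)
have c0 : 0 < c.
  have : 0 < c * (x * y)^-1 `^ (1 - eps) * (p * q).
    by apply: lt_le_trans hq; rewrite subr_gt0.
  by rewrite !pmulr_lgt0 ?mulr_gt0 // powR_gt0 // invr_gt0.
apply: (le_trans hq); rewrite E -!mulrA [leRHS]mulrCA ler_pM2l //.
set L := ln x in L0 qle *; set u := x `^ eps in eS *; set v := y `^ eps in eS *.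
have u0 : 0 < u by exact: powR_gt0.
have v0 : 0 < v by exact: powR_gt0.
have -> : u * (v * ((x * y)^-1 * (p * q))) = u * v * (p * q) / (x * y).
  by field; rewrite !lt0r_neq0.
rewrite ler_pdivrMr //.
have uv : u * v <= u * (50 / 49 * u) by rewrite ler_pM2l.
have xL : 0 <= x * L by rewrite mulr_ge0 //; lra.
have PQ : p * q <= 7 / 5 * (x * L) * (7 / 5 * (x * L)).
  exact: ler_pM (ltW p0) (ltW q0) (le_trans (ltW pq) qle) qle.
apply: (@le_trans _ _ (u * (50 / 49 * u) * (7 / 5 * (x * L) * (7 / 5 * (x * L))))).
  by apply: ler_pM uv PQ; rewrite ltW // mulr_gt0.
have -> : u * (50 / 49 * u) * (7 / 5 * (x * L) * (7 / 5 * (x * L))) =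
  2 * (u * L) ^+ 2 * (x * x) by field.
(* The constants multiply to exactly 2, so only x * x <= x * y remains. *)
by apply: ler_wpM2l; [rewrite mulr_ge0 ?sqr_ge0 | rewrite ler_pM2l].
Unshelve. all: by end_near. Qed.
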